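(* If $P\in\mathbb{H}[X]$ is a quaternionic polynomial of degree $d$, then $\|P'\|\le d\,\|P\|$.
   Context: $\mathbb{H}$ is the real algebra of quaternions with its Euclidean norm $|\cdot|$. $\mathbb{H}[X]$ is the ring of polynomials $P(X)=\sum_{h=0}^d X^h a_h$ with coefficients $a_h\in\mathbb{H}$ written on the right of the indeterminate. Such a polynomial is evaluated at $x\in\mathbb{H}$ by $P(x)=\sum_{h=0}^d x^h a_h$, and its derivative is the polynomial $P'(X)=\sum_{h=1}^d X^{h-1}h\,a_h$. The sup-norm of $P\in\mathbb{H}[X]$ on the unit ball is $\|P\|=\max_{|x|=1}|P(x)|=\max_{|x|\le1}|P(x)|$, where $x$ ranges in $\mathbb{H}$ (the two maxima coincide by the maximum modulus principle for quaternionic polynomials). *)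

(* Defs.v *)
(* MathComp and MathComp-Analysis; the reals are any [R : realType]. *)
From HB Require Import structures.
From mathcomp Require Import all_boot all_order all_algebra.
From mathcomp Require Import ring lra.
From mathcomp Require Import all_classical all_reals all_analysis.

Set Implicit Arguments.
Unset Strict Implicit.
Unset Printing Implicit Defensive.

Import Order.TTheory GRing.Theory Num.Theory.
Import numFieldNormedType.Exports.
Local Open Scope classical_set_scope.
Local Open Scope ring_scope.

(* [Quat a b c d] is a + b i + c j + d k. *)
Record quat (R : Type) := Quat { qre : R; qi : R; qj : R; qk : R }.

Section QuatChoice.
Context {R : Type}.
Definition quat_tuple (x : quat R) : R * R * R * R :=
  (qre x, qi x, qj x, qk x).
Definition tuple_quat (t : R * R * R * R) : quat R :=
  Quat t.1.1.1 t.1.1.2 t.1.2 t.2.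
Lemma quat_tupleK : cancel quat_tuple tuple_quat.
Proof. by case. Qed.
End QuatChoice.

HB.instance Definition _ (R : choiceType) :=
  Choice.copy (quat R) (can_type (@quat_tupleK R)).

Section QuatRing.
Context {R : comNzRingType}.
Implicit Types x y z : quat R.

Definition addq x y :=
  Quat (qre x + qre y) (qi x + qi y) (qj x + qj y) (qk x + qk y).
Definition oppq x := Quat (- qre x) (- qi x) (- qj x) (- qk x).
Definition zeroq : quat R := Quat 0 0 0 0.
Definition oneq : quat R := Quat 1 0 0 0.
Definition mulq x y :=
  Quat (qre x * qre y - qi x * qi y - qj x * qj y - qk x * qk y)
       (qre x * qi y + qi x * qre y + qj x * qk y - qk x * qj y)
       (qre x * qj y - qi x * qk y + qj x * qre y + qk x * qi y)
       (qre x * qk y + qi x * qj y - qj x * qi y + qk x * qre y).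

Lemma addqA : associative addq.
Proof. by move=> [a b c d] [e f g h] [i j k l]; rewrite /addq /= !addrA. Qed.
Lemma addqC : commutative addq.
Proof. by move=> [a b c d] [e f g h]; congr Quat => /=; ring. Qed.
Lemma add0q : left_id zeroq addq.
Proof. by move=> [a b c d]; rewrite /addq /= !add0r. Qed.
Lemma addNq : left_inverse zeroq oppq addq.
Proof. by move=> [a b c d]; rewrite /addq /= !addNr. Qed.

HB.instance Definition _ :=
  GRing.isZmodule.Build (quat R) addqA addqC add0q addNq.

Lemma mulqA : associative mulq.
Proof. by move=> [a b c d] [e f g h] [i j k l]; congr Quat => /=; ring. Qed.
Lemma mul1q : left_id oneq mulq.
Proof. by move=> [a b c d]; congr Quat => /=; ring. Qed.
Lemma mulq1 : right_id oneq mulq.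
Proof. by move=> [a b c d]; congr Quat => /=; ring. Qed.
Lemma mulqDl : left_distributive mulq +%R.
Proof. by move=> [a b c d] [e f g h] [i j k l]; congr Quat => /=; ring. Qed.
Lemma mulqDr : right_distributive mulq +%R.
Proof. by move=> [a b c d] [e f g h] [i j k l]; congr Quat => /=; ring. Qed.
Lemma oneq_neq0 : oneq != 0.
Proof. by apply/eqP => -[] /eqP; rewrite oner_eq0. Qed.

HB.instance Definition _ :=
  GRing.Zmodule_isNzRing.Build (quat R) mulqA mul1q mulq1 mulqDl mulqDr
    oneq_neq0.

End QuatRing.

Section SupNorm.
Context {R : realType}.
Implicit Types (x : quat R) (P : {poly quat R}).

Definition qnorm x : R :=
  Num.sqrt (qre x ^+ 2 + qi x ^+ 2 + qj x ^+ 2 + qk x ^+ 2).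

(* The indeterminate of [{poly quat R}] is central, so this ring and its
   derivative do not depend on the side on which coefficients are written, but
   evaluation does: [P.[x]] is the sum of the [P`_h * x ^+ h]. *)
Definition qeval P x : quat R := \sum_(h < size P) x ^+ h * P`_h.

Definition qsupnorm P : R :=
  sup [set qnorm (qeval P x) | x in [set x | qnorm x = 1]].

Definition quat_rV (v : 'rV[R]_4) : quat R :=
  Quat (v 0 (inord 0)) (v 0 (inord 1)) (v 0 (inord 2)) (v 0 (inord 3)).

Definition qcont (f : 'rV[R]_4 -> quat R) :=
  [/\ continuous (fun v => qre (f v)), continuous (fun v => qi (f v)),
      continuous (fun v => qj (f v)) & continuous (fun v => qk (f v))].

Lemma qcont_cst x : qcont (fun=> x).
Proof. by split; exact: cst_continuous. Qed.

Lemma qcont_quat : qcont quat_rV.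
Proof. by split; exact: coord_continuous. Qed.

Lemma qcontD f g : qcont f -> qcont g -> qcont (fun v => f v + g v).
Proof.
move=> [f0 f1 f2 f3] [g0 g1 g2 g3]; split=> v.
- exact: (cvgD (f0 v) (g0 v)).
- exact: (cvgD (f1 v) (g1 v)).
- exact: (cvgD (f2 v) (g2 v)).
- exact: (cvgD (f3 v) (g3 v)).
Qed.

Lemma qcontM f g : qcont f -> qcont g -> qcont (fun v => f v * g v).
Proof.
move=> [f0 f1 f2 f3] [g0 g1 g2 g3]; split=> v.
- exact: (cvgB (cvgB (cvgB (cvgM (f0 v) (g0 v))
      (cvgM (f1 v) (g1 v)))
      (cvgM (f2 v) (g2 v)))
      (cvgM (f3 v) (g3 v))).
- exact: (cvgB (cvgD (cvgD (cvgM (f0 v) (g1 v))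
      (cvgM (f1 v) (g0 v)))
      (cvgM (f2 v) (g3 v)))
      (cvgM (f3 v) (g2 v))).
- exact: (cvgD (cvgD (cvgB (cvgM (f0 v) (g2 v))
      (cvgM (f1 v) (g3 v)))
      (cvgM (f2 v) (g0 v)))
      (cvgM (f3 v) (g1 v))).
- exact: (cvgD (cvgB (cvgD (cvgM (f0 v) (g3 v))
      (cvgM (f1 v) (g2 v)))
      (cvgM (f2 v) (g1 v)))
      (cvgM (f3 v) (g0 v))).
Qed.

Lemma qcontX n : qcont (fun v => quat_rV v ^+ n).
Proof.
elim: n => [|n IH]; first exact: qcont_cst.
rewrite (_ : (fun v => _) = (fun v => quat_rV v * quat_rV v ^+ n)); last first.
  by apply/funext => v; rewrite exprS.
exact: qcontM qcont_quat IH.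
Qed.

Lemma qcont_qeval P : qcont (fun v => qeval P (quat_rV v)).
Proof.
rewrite /qeval; elim: (size P) => [|n IH].
  rewrite (_ : (fun v => _) = (fun=> 0)); first exact: qcont_cst.
  by apply/funext => v; rewrite big_ord0.
rewrite (_ : (fun v => _) = (fun v =>
    (\sum_(h < n) quat_rV v ^+ h * P`_h) + quat_rV v ^+ n * P`_n)).
  by apply: qcontD IH _; apply: qcontM (qcontX n) (qcont_cst _).
by apply/funext => v; rewrite big_ord_recr.
Qed.

Lemma continuous_qnorm f : qcont f -> continuous (fun v => qnorm (f v)).
Proof.
move=> [f0 f1 f2 f3] v; rewrite /qnorm.
apply: (@continuous_comp _ _ _ (fun v => _) Num.sqrt); last exact: sqrt_continuous.
exact: (cvgD (cvgD (cvgD (cvgM (f0 v) (f0 v)) (cvgM (f1 v) (f1 v)))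
  (cvgM (f2 v) (f2 v))) (cvgM (f3 v) (f3 v))).
Qed.

Lemma quat_rV_surj x : exists v, quat_rV v = x.
Proof.
exists (\row_i nth 0 [:: qre x; qi x; qj x; qk x] i).
by case: x => a b c d; rewrite /quat_rV !mxE !inordK.
Qed.

Lemma qsupnorm_max P : exists2 x, qnorm x = 1 &
  qsupnorm P = qnorm (qeval P x) /\
  forall y, qnorm y = 1 -> qnorm (qeval P y) <= qnorm (qeval P x).
Proof.
pose A := [set v : 'rV[R]_4 | qnorm (quat_rV v) = 1].
have A0 : A !=set0.
  have [v v1] := quat_rV_surj 1; exists v; rewrite /A /= v1 /qnorm /=.
  by rewrite expr1n expr0n /= !addr0 sqrtr1.
have cA : compact A.
  apply: bounded_closed_compact.
    exists 1; split=> // r r1 v /= Av.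
    rewrite (le_trans _ (ltW r1))//.
    rewrite [leLHS]mx_normrE; apply/bigmax_leP; split=> // -[i j] _ /=.
    rewrite -(ler_pXn2r (n := 2)) ?nnegrE// expr1n -normrX ger0_norm ?sqr_ge0//.
    move: Av; rewrite /A /= /qnorm => /(congr1 (fun t : R => t ^+ 2)).
    rewrite sqr_sqrtr ?addr_ge0 ?sqr_ge0// expr1n => <- /=.
    have -> : i = 0 by apply/val_inj; case: i => -[].
    have p (k : 'I_4) := sqr_ge0 (v 0 k).
    have : [|| j == inord 0, j == inord 1, j == inord 2 | j == inord 3] :> bool.
      by case: j => -[|[|[|[|]]]] // jj; rewrite -!val_eqE /= !inordK.
    case/or4P => /eqP ->; have := p (inord 0); have := p (inord 1);
      have := p (inord 2); have := p (inord 3); lra.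
  rewrite (_ : A = (fun v => qnorm (quat_rV v)) @^-1` [set 1]) //.
  apply: closed_comp; last exact: closed_eq.
  by move=> v _; apply: continuous_qnorm qcont_quat v.
have [|v Av vmax] := @EVT_max_rV R 4 (fun v => qnorm (qeval P (quat_rV v))) A A0 cA.
  by apply: continuous_subspaceT; apply: continuous_qnorm (qcont_qeval P).
have Av1 : qnorm (quat_rV v) = 1 by move: Av; rewrite inE.
exists (quat_rV v) => //.
have mx y : qnorm y = 1 -> qnorm (qeval P y) <= qnorm (qeval P (quat_rV v)).
  by have [w <- wA] := quat_rV_surj y; apply: vmax; rewrite inE.
split=> //; apply/eqP; rewrite eq_le; apply/andP; split.
  apply: ge_sup => [|_ [y y1 <-]]; last exact: mx.
  by exists (qnorm (qeval P (quat_rV v))), (quat_rV v).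
apply: ub_le_sup; last by exists (quat_rV v).
by exists (qnorm (qeval P (quat_rV v))) => _ [y y1 <-]; exact: mx.
Qed.

End SupNorm.

(* Main.v *)
Require Import Defs.
From HB Require Import structures.
From mathcomp Require Import all_boot all_order all_algebra.
From mathcomp Require Import all_classical all_reals all_analysis.
From mathcomp Require Import ring lra zify.

(** The inequality follows from an exact quadrature formula for the derivative,
the quaternionic form of M. Riesz's interpolation formula.

Let |x| = 1 and choose an imaginary unit I commuting with x; the plane spanned
by 1 and I is a copy of the complex numbers containing x ([imag_unit_commute]).
Write w_k = cos t_k + I sin t_k, where t_k = (2k+1) pi / d and 0 <= k < d: these
are the d-th roots of -1 in that plane.  With the nonnegative weights
F_k = |1 + w_k + ... + w_k^(d-1)|^2 one has, for 0 <= h <= d,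

  sum_k F_k w_k^h = d (d - 2h),

which is [sum_fejer_cis]: expand F_k as a double sum of powers of w_k and use
the orthogonality of these powers ([sum_cis_node_orth]).  Since x commutes with
w_k, multiplying by x^h on the left and by the coefficient a_h on the right and
summing over h gives [riesz_interpolation]:

  2 d x P'(x) = d^2 P(x) - sum_k F_k P(x w_k).

Noncommutativity does no harm: the coefficients only ever stand on the right,
and everything to their left lies in one commutative plane.  All the points
x w_k are unit quaternions, and the case h = 0 gives sum_k F_k = d^2, so the
right-hand side has norm at most 2 d^2 ||P||; dividing by 2 d concludes. *)

Import Order.TTheory GRing.Theory Num.Theory.
Local Open Scope ring_scope.

(** * Sums of cosines and sines at odd multiples of an angle *)

Section Trig.
Context {R : realType}.
Implicit Types (t : R).

(** Multiplying by 2 sin t makes the sum telescope; likewise for the sines in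
[sum_sin_odd]. *)
Lemma sum_cos_odd t n :
  2 * sin t * \sum_(k < n) cos ((2 * k + 1)%:R * t) = sin ((2 * n)%:R * t).
Proof.
elim: n => [|n IHn]; first by rewrite big_ord0 mulr0 mul0r sin0.
rewrite big_ord_recr /= mulrDr IHn.
have -> : (2 * n)%:R * t = (2 * n + 1)%:R * t - t by rewrite natrD; ring.
have -> : (2 * n.+1)%:R * t = (2 * n + 1)%:R * t + t
  by rewrite mulnS natrD [in RHS]natrD; ring.
rewrite sinB sinD; ring.
Qed.

Lemma sum_sin_odd t n :
  2 * sin t * \sum_(k < n) sin ((2 * k + 1)%:R * t) = 1 - cos ((2 * n)%:R * t).
Proof.
elim: n => [|n IHn]; first by rewrite big_ord0 mulr0 mul0r cos0 subrr.
rewrite big_ord_recr /= mulrDr IHn.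
have -> : (2 * n)%:R * t = (2 * n + 1)%:R * t - t by rewrite natrD; ring.
have -> : (2 * n.+1)%:R * t = (2 * n + 1)%:R * t + t
  by rewrite mulnS natrD [in RHS]natrD; ring.
rewrite cosB cosD; ring.
Qed.

Lemma cos_sin_nat_pi n :
  cos (n%:R * pi : R) = (-1) ^+ n /\ sin (n%:R * pi : R) = 0.
Proof.
elim: n => [|n [c s]]; first by rewrite mul0r cos0 sin0.
by rewrite -natr1 mulrDl mul1r cosDpi sinDpi c s exprS mulN1r oppr0.
Qed.

(** Here -d < n - j < 2d, so the angle is a multiple of pi only when n - j is 0
or d. *)
Lemma sin_rat_pi_neq0 d n j : (n < 2 * d)%N -> (j < d)%N ->
  n != j -> n != (j + d)%N -> sin ((n%:R - j%:R) * pi / d%:R : R) != 0.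
Proof.
move=> nd jd nj njd; have d0 : (0 < d)%N by lia.
have dR : 0 < d%:R :> R by rewrite ltr0n.
have pos m : (0 < m < d)%N -> 0 < sin (m%:R * pi / d%:R : R).
  move=> /andP[m0 md]; apply: sin_gt0_pi.
  rewrite divr_gt0 ?mulr_gt0 ?pi_gt0 ?ltr0n//=.
  by rewrite ltr_pdivrMr// mulrC ltr_pM2l ?pi_gt0// ltr_nat.
have [lt_nj|le_jn] := ltnP n j.
  rewrite -opprB -natrB 1?ltnW// !mulNr sinN oppr_eq0 gt_eqF// pos//; lia.
rewrite -natrB//; have [lt_d|le_d] := ltnP (n - j) d.
  by rewrite gt_eqF// pos//; lia.
rewrite -(subnK le_d) natrD !mulrDl [d%:R * _]mulrC.
rewrite (mulfK (lt0r_neq0 dR)) sinDpi.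
rewrite oppr_eq0 gt_eqF// pos//; lia.
Qed.

End Trig.

(** * Quaternions as an algebra with conjugation and norm *)

Section QuatAlgebra.
Context {R : comNzRingType}.
Implicit Types x y : quat R.

Definition scaleq (c : R) x :=
  Quat (c * qre x) (c * qi x) (c * qj x) (c * qk x).

Lemma scaleqA a b x : scaleq a (scaleq b x) = scaleq (a * b) x.
Proof. by rewrite /scaleq /= !mulrA. Qed.
Lemma scale1q : left_id 1 scaleq.
Proof. by case=> a b c d; rewrite /scaleq /= !mul1r. Qed.
Lemma scaleqDr : right_distributive scaleq +%R.
Proof. by move=> t [a b c d] [e f g h]; congr Quat => /=; ring. Qed.
Lemma scaleqDl x : {morph scaleq^~ x : a b / a + b}.
Proof. by move=> s t; case: x => a b c d; congr Quat => /=; ring. Qed.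

HB.instance Definition _ :=
  GRing.Zmodule_isLmodule.Build R (quat R) scaleqA scale1q scaleqDr scaleqDl.

Lemma scaleqAl (c : R) x y : c *: (x * y) = (c *: x) * y.
Proof. by case: x y => a b e d [e' f g h]; congr Quat => /=; ring. Qed.

HB.instance Definition _ := GRing.Lmodule_isLalgebra.Build R (quat R) scaleqAl.

Lemma scaleqAr (c : R) x y : c *: (x * y) = x * (c *: y).
Proof. by case: x y => a b e d [e' f g h]; congr Quat => /=; ring. Qed.

HB.instance Definition _ := GRing.Lalgebra_isAlgebra.Build R (quat R) scaleqAr.

Definition conjq x := Quat (qre x) (- qi x) (- qj x) (- qk x).

Definition sqnormq x : R := qre x ^+ 2 + qi x ^+ 2 + qj x ^+ 2 + qk x ^+ 2.

Lemma conjqD x y : conjq (x + y) = conjq x + conjq y.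
Proof. by case: x y => a b c d [e f g h]; congr Quat => /=; ring. Qed.

Lemma conjq_sum n (F : 'I_n -> quat R) :
  conjq (\sum_i F i) = \sum_i conjq (F i).
Proof.
apply: (big_morph conjq conjqD).
by rewrite /conjq /= !oppr0.
Qed.

Lemma conjqZ c x : conjq (c *: x) = c *: conjq x.
Proof. by case: x => a b e d; congr Quat => /=; ring. Qed.

Lemma mulq_conj x : x * conjq x = sqnormq x *: 1.
Proof. by case: x => a b c d; congr Quat => /=; rewrite /sqnormq /=; ring. Qed.

Lemma sqnormqM x y : sqnormq (x * y) = sqnormq x * sqnormq y.
Proof. by case: x y => a b c d [e f g h]; rewrite /sqnormq /=; ring. Qed.

Lemma sqnorm_conjq x : sqnormq (conjq x) = sqnormq x.
Proof. by rewrite /sqnormq /= !sqrrN. Qed.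

End QuatAlgebra.

Section QuatNorm.
Context {R : realType}.
Implicit Types (x y : quat R) (P : {poly quat R}).

Lemma sqnormq_ge0 x : 0 <= sqnormq x.
Proof. by rewrite /sqnormq !addr_ge0 ?sqr_ge0. Qed.

Lemma qnorm_ge0 x : 0 <= qnorm x.
Proof. exact: sqrtr_ge0. Qed.

Lemma sqr_qnorm x : qnorm x ^+ 2 = sqnormq x.
Proof. by rewrite sqr_sqrtr ?sqnormq_ge0. Qed.

Lemma qnormM x y : qnorm (x * y) = qnorm x * qnorm y.
Proof. by rewrite /qnorm -!/(sqnormq _) sqnormqM sqrtrM ?sqnormq_ge0. Qed.

Lemma qnorm_scale (c : R) x : qnorm (c *: x) = `|c| * qnorm x.
Proof.
rewrite -sqrtr_sqr /qnorm -!/(sqnormq _) -sqrtrM ?sqr_ge0//; congr Num.sqrt.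
by rewrite /sqnormq /=; ring.
Qed.

(** Applied to x * conjq y, this is the Cauchy-Schwarz inequality behind the
triangle inequality [qnormD]. *)
Lemma qre_le_qnorm x : qre x <= qnorm x.
Proof.
apply: le_trans (ler_norm _) _; rewrite -sqrtr_sqr; apply: ler_wsqrtr.
by rewrite -!addrA lerDl !addr_ge0 ?sqr_ge0.
Qed.

Lemma qnormD x y : qnorm (x + y) <= qnorm x + qnorm y.
Proof.
rewrite -ler_sqr ?nnegrE ?addr_ge0 ?qnorm_ge0//.
rewrite sqrrD !sqr_qnorm.
have -> : sqnormq (x + y) = sqnormq x + qre (x * conjq y) *+ 2 + sqnormq y.
  by case: x y => a b c d [e f g h]; rewrite /sqnormq /=; ring.
rewrite lerD2r lerD2l ler_pMn2r //.
rewrite (le_trans (qre_le_qnorm _))// qnormM.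
by rewrite {2}/qnorm -/(sqnormq _) sqnorm_conjq.
Qed.

Lemma qnorm0 : qnorm (0 : quat R) = 0.
Proof. by rewrite /qnorm /= expr0n /= !addr0 sqrtr0. Qed.

Lemma qnorm_sum n (F : 'I_n -> quat R) :
  qnorm (\sum_i F i) <= \sum_i qnorm (F i).
Proof.
elim/big_ind2: _ => [|x a y b xa yb|i _]; rewrite ?qnorm0//.
by rewrite (le_trans (qnormD _ _))// lerD.
Qed.

Lemma qnormB x y : qnorm (x - y) <= qnorm x + qnorm y.
Proof.
by rewrite (le_trans (qnormD _ _))// -scaleN1r qnorm_scale normrN1 mul1r.
Qed.

Lemma qsupnorm_ub P x : qnorm x = 1 -> qnorm (qeval P x) <= qsupnorm P.
Proof. by move=> x1; have [y _ [-> ymax]] := qsupnorm_max P; exact: ymax. Qed.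

(** * Evaluation of polynomials *)

Lemma qeval_wide n P x : (size P <= n)%N ->
  qeval P x = \sum_(h < n) x ^+ h * P`_h.
Proof.
move=> Pn; rewrite /qeval (big_ord_widen n (fun h => x ^+ h * P`_h))//.
rewrite big_mkcond; apply: eq_bigr => h _; case: ltnP => // hP.
by rewrite nth_default ?mulr0.
Qed.

(** The extra factor x aligns the powers of x with those of P itself, so that P'
and P can be compared coefficient by coefficient. *)
Lemma mul_qeval_deriv n P x : (size P <= n)%N ->
  x * qeval P^`() x = \sum_(h < n) h%:R *: (x ^+ h * P`_h).
Proof.
case: n => [|n] Pn.
  rewrite big_ord0 (_ : P = 0) ?deriv0; last first.
    by apply/eqP; rewrite -size_poly_eq0 -leqn0.
  by rewrite /qeval size_poly0 big_ord0 mulr0.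
rewrite (@qeval_wide n); last first.
  by rewrite (leq_trans (size_poly _ _))//; case: (size P) Pn.
rewrite big_ord_recl scale0r add0r mulr_sumr; apply: eq_bigr => h _.
by rewrite coef_deriv scaler_nat mulrA -exprS mulrnAr.
Qed.

(** * The complex plane through a quaternion *)

Definition imag_unit (I : quat R) := qre I = 0 /\ qnorm I = 1.

(** Normalize the imaginary part of x; when that part vanishes, x is real and
any imaginary unit will do. *)
Lemma imag_unit_commute x : exists2 I, imag_unit I & GRing.comm x I.
Proof.
pose v := Quat 0 (qi x) (qj x) (qk x).
have xv : GRing.comm x v.
  rewrite /GRing.comm /v; case: x {v} => a b c d; congr Quat => /=; ring.
have [v0|v0] := eqVneq (qnorm v) 0.
  have vE : v = 0.
    have : sqnormq v = 0 by rewrite -sqr_qnorm v0 expr0n.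
    rewrite /sqnormq /= /v => h.
    have p := (sqr_ge0 (qi x), sqr_ge0 (qj x), sqr_ge0 (qk x)).
    have : qi x ^+ 2 = 0 by move: p => [[? ?] ?]; lra.
    have : qj x ^+ 2 = 0 by move: p => [[? ?] ?]; lra.
    have : qk x ^+ 2 = 0 by move: p => [[? ?] ?]; lra.
    by move=> /eqP; rewrite sqrf_eq0 => /eqP -> /eqP;
      rewrite sqrf_eq0 => /eqP -> /eqP; rewrite sqrf_eq0 => /eqP ->.
  exists (Quat 0 1 0 0).
    by split=> //; rewrite /qnorm /= expr1n expr0n /= add0r !addr0 sqrtr1.
  case: x @v xv v0 vE => a b c d v _ _ [-> -> ->].
  by congr Quat => /=; ring.
exists ((qnorm v)^-1 *: v).
  split; first by rewrite /= mulr0.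
  by rewrite qnorm_scale ger0_norm ?invr_ge0 ?qnorm_ge0 ?mulVf.
by rewrite /GRing.comm -scalerAr -scalerAl xv.
Qed.

Definition cis (I : quat R) (t : R) : quat R := cos t *: 1 + sin t *: I.

Section Slice.
Variable I : quat R.
Hypothesis hI : imag_unit I.

Lemma sqr_imag_unit : I * I = -1.
Proof.
have [I0 /(congr1 (fun r => r ^+ 2))] := hI; rewrite sqr_qnorm expr1n.
case: I I0 => a b c d /= ->; rewrite /sqnormq /= => h.
by congr Quat => /=; try (ring); lra.
Qed.

Lemma cisD s t : cis I (s + t) = cis I s * cis I t.
Proof.
rewrite /cis mulrDl !mulrDr -!scalerAl -!scalerAr !scalerA !mul1r mulr1.
rewrite sqr_imag_unit cosD sinD scalerBl scalerDl scalerN.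
rewrite [sin s * cos t]mulrC addrACA -!addrA; congr (_ + _).
by rewrite [RHS]addrC -addrA.
Qed.

Lemma cis0 : cis I 0 = 1.
Proof. by rewrite /cis cos0 sin0 scale1r scale0r addr0. Qed.

Lemma cisX t n : cis I t ^+ n = cis I (n%:R * t).
Proof.
elim: n => [|n IHn]; first by rewrite mul0r cis0.
by rewrite exprS IHn -cisD -natr1 mulrDl mul1r addrC.
Qed.

Lemma conj_cis t : conjq (cis I t) = cis I (- t).
Proof.
rewrite /cis conjqD !conjqZ cosN sinN scaleNr -scalerN.
congr (_ *: _ + _ *: _); first by congr Quat => /=; rewrite oppr0.
by have [I0 _] := hI; case: I I0 => a b c d /= ->; congr Quat; rewrite /= oppr0.
Qed.

Lemma qnorm_cis t : qnorm (cis I t) = 1.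
Proof.
have: sqnormq (cis I t) *: (1 : quat R) = 1.
  by rewrite -mulq_conj conj_cis -cisD subrr cis0.
move/(congr1 (@qre R)); rewrite /= mulr1 /qnorm -/(sqnormq _) => ->.
exact: sqrtr1.
Qed.

(** * Riesz interpolation at the roots of -1 *)

(** The arguments of the d-th roots of -1. *)
Definition node (d k : nat) : R := (2 * k + 1)%:R * (pi / d%:R).

(** The n-th and j-th powers of the roots w of -1 are orthogonal unless n and j
are congruent modulo d.  The window for n exceeds a period because n is later
the sum of two exponents; the second nonzero case is w^d = -1. *)
Lemma sum_cis_node_orth d n j : (n < 2 * d)%N -> (j < d)%N ->
  \sum_(k < d) cis I ((n%:R - j%:R) * node d k) =
  ((if n == j then d%:R else if n == (j + d)%N then - d%:R else 0) : R) *: 1.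
Proof.
move=> nd jd; have d0 : d%:R != 0 :> R by rewrite pnatr_eq0; lia.
pose a : R := (n%:R - j%:R) * pi / d%:R.
have E (k : 'I_d) : (n%:R - j%:R) * node d k = (2 * k + 1)%:R * a.
  by rewrite /node /a; ring.
rewrite (eq_bigr (fun k : 'I_d => cos ((2 * k + 1)%:R * a) *: 1 +
  sin ((2 * k + 1)%:R * a) *: I)); last by move=> k _; rewrite E.
case: eqVneq => [nj|nj].
  rewrite (eq_bigr (fun=> 1)) ?sumr_const ?card_ord ?scaler_nat// => k _.
  by rewrite /a nj subrr !mul0r !mulr0 cos0 sin0 scale1r scale0r addr0.
case: eqVneq => [njd|njd].
  rewrite (eq_bigr (fun=> -1)) ?sumr_const ?card_ord.
    by rewrite scaleNr scaler_nat mulNrn.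
  move=> k _; have -> : a = pi by rewrite /a njd natrD; field.
  have [-> ->] := cos_sin_nat_pi (R := R) (2 * k + 1).
  by rewrite exprD exprM sqrrN expr1n expr1n mul1r scale0r addr0 scaleN1r.
have sa0 : sin a != 0 by exact: sin_rat_pi_neq0.
have s2 : 2 * sin a != 0 by rewrite mulf_neq0 ?pnatr_eq0.
have aE : (2 * d)%:R * a = (2 * n)%:R * pi - (2 * j)%:R * pi.
  by rewrite /a !natrM; field.
have [cn sn] := cos_sin_nat_pi (R := R) (2 * n).
have [cj sj] := cos_sin_nat_pi (R := R) (2 * j).
rewrite big_split /= -!scaler_suml.
have -> : \sum_(k < d) cos ((2 * k + 1)%:R * a) = 0.
  apply: (mulfI s2); rewrite mulr0 sum_cos_odd aE sinB sn sj.
  by rewrite mul0r mulr0 subrr.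
have -> : \sum_(k < d) sin ((2 * k + 1)%:R * a) = 0.
  apply: (mulfI s2); rewrite mulr0 sum_sin_odd aE cosB cn cj sn.
  by rewrite mul0r addr0 !exprM sqrrN !expr1n mul1r subrr.
by rewrite !scale0r addr0.
Qed.

(** This is d times the Fejer kernel at the k-th root of -1.  The form of a
squared norm gives both nonnegativity and, through [mulq_conj], the expansion
[fejer_cis] into powers of the root. *)
Definition fejer d k : R := sqnormq (\sum_(i < d) cis I (i%:R * node d k)).

Lemma fejer_ge0 d k : 0 <= fejer d k.
Proof. exact: sqnormq_ge0. Qed.

Lemma fejer_cis d k t : fejer d k *: cis I t =
  \sum_(i < d) \sum_(j < d) cis I (i%:R * node d k - j%:R * node d k + t).
Proof.
rewrite -[cis I t]mul1r scalerAl -mulq_conj conjq_sum -mulrA mulr_suml.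
apply: eq_bigr => i _; rewrite mulr_suml mulr_sumr; apply: eq_bigr => j _.
by rewrite conj_cis// mulrA -!cisD.
Qed.

(** After expanding the kernel, each i < d meets exactly one j < d that is
congruent to i + h modulo d: j = i + h when i < d - h, which contributes d, and
j = i + h - d otherwise, which contributes -d. *)
Lemma sum_fejer_cis d h : (h <= d)%N ->
  \sum_(k < d) fejer d k *: cis I (h%:R * node d k) =
  (d%:R * (d%:R - 2 * h%:R) : R) *: 1.
Proof.
move=> hd.
under eq_bigr => k _ do rewrite fejer_cis.
rewrite exchange_big /=.
rewrite (eq_bigr (fun i : 'I_d =>
  (d%:R * (if (i < d - h)%N then 1 else -1) : R) *: 1)); last first.
  move=> i _; rewrite exchange_big /=.
  rewrite (eq_bigr (fun j : 'I_d => ((if (i + h)%N == j then d%:R else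
      if (i + h)%N == (j + d)%N then - d%:R else 0) : R) *: 1)); last first.
    move=> j _; rewrite -sum_cis_node_orth//; last by have := ltn_ord i; lia.
    by apply: eq_bigr => k _; congr cis; rewrite natrD; ring.
  rewrite -scaler_suml; congr (_ *: _).
  have id := ltn_ord i; have [lt_i|le_i] := ltnP i (d - h).
    have lt_ih : (i + h < d)%N by lia.
    rewrite (bigD1 (Ordinal lt_ih))//= eqxx big1 ?addr0 ?mulr1// => j jne.
    by rewrite ifN ?ifN//; [lia|rewrite eq_sym].
  have lt_ih : (i + h - d < d)%N by lia.
  rewrite (bigD1 (Ordinal lt_ih))//= ifN; last by lia.
  rewrite ifT; last by lia.
  rewrite big1 ?addr0 ?mulrN1// => j; rewrite -val_eqE /= => jne.
  by have jd := ltn_ord j; rewrite ifN ?ifN//; lia.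
rewrite -scaler_suml -mulr_sumr; congr (_ * _ *: _).
rewrite -(big_mkord xpredT (fun i => if (i < d - h)%N then 1 else -1)).
rewrite (big_cat_nat (n := d - h))//=; last exact: leq_subr.
rewrite (eq_big_nat _ _ (F2 := fun=> 1)); last by move=> i /andP[_ ->].
rewrite (eq_big_nat _ _ (F1 := fun i => if _ then _ else _) (F2 := fun=> -1)).
  by rewrite !sumr_const_nat subn0 subKn// natrB// mulNrn; ring.
by move=> i /andP[di _]; rewrite ltnNge di.
Qed.

(** The case h = 0 of [sum_fejer_cis].  That the total weight is as large as the
coefficient of P(x) in [riesz_interpolation], and no larger, is what yields the
sharp constant d. *)
Lemma sum_fejer d : \sum_(k < d) fejer d k = d%:R ^+ 2.
Proof.
have := sum_fejer_cis d 0 (leq0n d).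
under eq_bigr => k _ do rewrite mul0r cis0.
rewrite -scaler_suml mulr0 subr0 => /(congr1 (@qre R)) /=.
by rewrite !mulr1.
Qed.

(** Coefficient by coefficient this is 2 d h = d^2 - d (d - 2 h), with
[sum_fejer_cis] supplying the last term. *)
Lemma riesz_interpolation d P x : GRing.comm x I -> (size P <= d.+1)%N ->
  (2 * d%:R) *: (x * qeval P^`() x) =
  d%:R ^+ 2 *: qeval P x -
  \sum_(k < d) fejer d k *: qeval P (x * cis I (node d k)).
Proof.
move=> xI Pd.
have xc t : GRing.comm x (cis I t).
  rewrite /GRing.comm /cis mulrDr mulrDl -!scalerAr -!scalerAl mulr1 mul1r.
  by rewrite xI.
under eq_bigr => k _ do rewrite (qeval_wide _ _ _ Pd) scaler_sumr.
rewrite (mul_qeval_deriv _ _ _ Pd) (qeval_wide _ _ _ Pd) exchange_big /=.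
rewrite !scaler_sumr -sumrB.
apply: eq_bigr => h _; have hd : (h <= d)%N by rewrite -ltnS.
rewrite (eq_bigr (fun k : 'I_d =>
  x ^+ h * (fejer d k *: cis I (h%:R * node d k)) * P`_h)); last first.
  by move=> k _; rewrite exprMn_comm// cisX -scalerAr -scalerAl.
rewrite -mulr_suml -mulr_sumr sum_fejer_cis// -scalerAr mulr1 -scalerAl scalerA.
by rewrite -scalerBl; congr (_ *: _); ring.
Qed.

End Slice.

Lemma bernstein_pointwise d P x : (0 < d)%N -> (size P <= d.+1)%N ->
  qnorm x = 1 -> qnorm (qeval P^`() x) <= d%:R * qsupnorm P.
Proof.
move=> d0 Pd x1; have [I hI xI] := imag_unit_commute x.
have dR : 0 < d%:R :> R by rewrite ltr0n.
have c0 : 0 < 2 * d%:R :> R by rewrite mulr_gt0.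
rewrite -(ler_pM2l c0).
have -> : 2 * d%:R * qnorm (qeval P^`() x) =
    qnorm ((2 * d%:R) *: (x * qeval P^`() x)).
  by rewrite qnorm_scale qnormM x1 mul1r gtr0_norm.
rewrite (riesz_interpolation _ hI)//.
rewrite (le_trans (qnormB _ _))//.
have -> : 2 * d%:R * (d%:R * qsupnorm P) =
  d%:R ^+ 2 * qsupnorm P + \sum_(k < d) fejer I d k * qsupnorm P.
  by rewrite -mulr_suml (sum_fejer _ hI); ring.
apply: lerD.
  rewrite qnorm_scale ger0_norm ?exprn_ge0//.
  by rewrite ler_wpM2l ?exprn_ge0 ?qsupnorm_ub.
rewrite (le_trans (qnorm_sum _ _))//; apply: ler_sum => k _.
rewrite qnorm_scale ger0_norm ?fejer_ge0// ler_wpM2l ?fejer_ge0//.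
by rewrite qsupnorm_ub// qnormM x1 (qnorm_cis _ hI) mulr1.
Qed.

End QuatNorm.

Theorem corollary2 (R : realType) (d : nat) (P : {poly quat R})
    (hd : (size P).-1 = d) :
  qsupnorm P^`() <= d%:R * qsupnorm P.
Proof.
have [x x1 [-> _]] := qsupnorm_max P^`().
have Pd : (size P <= d.+1)%N by rewrite -hd leqSpred.
have [d0|d0] := posnP d; last exact: bernstein_pointwise.
have -> : P^`() = 0.
  apply/eqP; rewrite -size_poly_eq0 -leqn0.
  by rewrite (leq_trans (size_poly _ _))// hd d0.
by rewrite /qeval size_poly0 big_ord0 qnorm0 d0 mul0r.
Qed.
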